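(* Let $\lambda=(\lambda_1,\dots,\lambda_m)$ be an $m$-row shape. Then $$\xi(q)=\sum_k|S_k(\lambda)|q^k=\sum_{(i_1,\dots,i_{m-1})}\Big(|\mathcal D_\lambda(i_1,\dots,i_{m-1})|\prod_{j=1}^{m-1}[j+1]_q^{\,i_j}\Big),$$ the sum ranging over all tuples of nonnegative integers.
   Context: $\lambda_1\ge\dots\ge\lambda_m\ge1$, $N=\sum\lambda_i$. A row-standard filling of shape $\lambda$ uses $1,\dots,N$ once each with rows strictly increasing left to right. Inversion pairs of a row-standard $\tau$: for a box $c$ and $r\ge1$ let $c^{(r)}$ be the box $r$ positions to its right, if it exists. For distinct boxes $c,c'$ in the same column with $\tau(c)<\tau(c')$, let $r\ge1$ be least such that one of $c^{(r)},c'^{(r)}$ does not exist or $\tau(c^{(r)})\ne\tau(c'^{(r)})$; $(c,c')$ is an inversion pair if either (one does not exist and $c$ lies below $c'$) or (both exist and $\tau(c^{(r)})>\tau(c'^{(r)})$). $S_k(\lambda)$: row-standard fillings of shape $\lambda$ with exactly $k$ inversion pairs. An $m$-dimensional Dyck path of shape $\lambda$ is a sequence $v_0,\dots,v_N\in\mathbb Z^m$ with $v_0=0$, $v_N=(\lambda_1,\dots,\lambda_m)$, each $v_i-v_{i-1}=\hat e_\gamma$ for some $\gamma$ (a ''$\gamma$-step''), and every $v_i=(x_1,\dots,x_m)$ satisfying $x_1\ge\dots\ge x_m$; $\mathcal D_\lambda$ is their set. If step $k$ is a $\gamma$-step and $v_k=(x'_1,\dots,x'_m)$, let $d\ge0$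 be the largest integer with $x'_{\gamma-d}=\dots=x'_\gamma$; $P$ has a $d$-degree return to ground at $v_k$. $\mathcal D_\lambda(i_1,\dots,i_{m-1})$ is the set of $P\in\mathcal D_\lambda$ having, for each $1\le d\le m-1$, exactly $i_d$ indices $k\in\{1,\dots,N\}$ at which $P$ has a $d$-degree return to ground. $[p]_q=1+q+\dots+q^{p-1}$. *)

(* Defs.v *)
From HB Require Import structures.
From mathcomp Require Import all_boot all_order all_algebra.
Set Implicit Arguments. Unset Strict Implicit. Unset Printing Implicit Defensive.
Import GRing.Theory.

(* A shape lam = [:: lam_1; ...; lam_m] (a seq nat). Rows are indexed
   0..m-1 (top to bottom, row 0 = longest), columns 0..lam_1-1. *)
Definition nrows (lam : seq nat) := size lam.
Definition ncols (lam : seq nat) := head 0 lam.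
Definition nboxes (lam : seq nat) := sumn lam.

Definition is_shape (lam : seq nat) : bool :=
  sorted geq lam && (0 \notin lam) && (0 < size lam).

Definition inShape (lam : seq nat) (i j : nat) : bool :=
  (i < size lam) && (j < nth 0 lam i).

(* A filling is stored as a function on the bounding rectangle; entries
   are in {0,..,N}, with 0 meaning "no box here". *)
Definition filling (lam : seq nat) :=
  {ffun 'I_(nrows lam) * 'I_(ncols lam) -> 'I_(nboxes lam).+1}.

Definition entry (lam : seq nat) (tau : filling lam) (i j : nat) : nat :=
  match (insub i : option 'I_(nrows lam)), (insub j : option 'I_(ncols lam)) with
  | Some i', Some j' => tau (i', j') : nat
  | _, _ => 0
  end.

(* row-standard: boxes of the shape get the values 1..N each once (injective
   with values in 1..N on N boxes), cells outside the shape get 0, and rows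
   strictly increase left to right. *)
Definition row_standard (lam : seq nat) (tau : filling lam) : bool :=
  [forall p : 'I_(nrows lam) * 'I_(ncols lam),
      inShape lam p.1 p.2 == (tau p != 0 :> nat)]
  && [forall p : 'I_(nrows lam) * 'I_(ncols lam), forall p' : 'I_(nrows lam) * 'I_(ncols lam),
       (inShape lam p.1 p.2 && inShape lam p'.1 p'.2 && (tau p == tau p')) ==> (p == p')]
  && [forall p : 'I_(nrows lam) * 'I_(ncols lam), forall p' : 'I_(nrows lam) * 'I_(ncols lam),
       ((p.1 == p'.1) && (p.2 < p'.2) && inShape lam p'.1 p'.2) ==> (tau p < tau p')].

Definition stop_at (lam : seq nat) (tau : filling lam) (i i' j r : nat) : bool :=
  ~~ (inShape lam i (j + r) && inShape lam i' (j + r))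
  || (entry tau i (j + r) != entry tau i' (j + r)).

(* least r >= 1 satisfying stop_at (it always exists with r <= ncols lam) *)
Definition least_r (lam : seq nat) (tau : filling lam) (i i' j : nat) : nat :=
  (find (stop_at tau i i' j) (iota 1 (ncols lam))).+1.

Definition inv_pair (lam : seq nat) (tau : filling lam) (i i' j : nat) : bool :=
  inShape lam i j && inShape lam i' j && (i != i')
  && (entry tau i j < entry tau i' j)
  && (let r := least_r tau i i' j in
      if inShape lam i (j + r) && inShape lam i' (j + r)
      then entry tau i' (j + r) < entry tau i (j + r)
      else i' < i (* c lies below c' *)).

Definition ninv (lam : seq nat) (tau : filling lam) : nat :=
  #|[set x : 'I_(nrows lam) * 'I_(nrows lam) * 'I_(ncols lam)
       | inv_pair tau x.1.1 x.1.2 x.2]|.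

Definition S_k (lam : seq nat) (k : nat) : {set filling lam} :=
  [set tau : filling lam | row_standard tau && (ninv tau == k)].

(* Dyck paths: a path v_0,...,v_N with v_0 = 0 and unit steps is determined by
   its sequence of step directions; gam t (0-indexed t < N) is the (0-indexed)
   direction gamma of step t+1. *)
Definition steps (lam : seq nat) := {ffun 'I_(nboxes lam) -> 'I_(nrows lam)}.

Definition vcoord (lam : seq nat) (P : steps lam) (k g : nat) : nat :=
  #|[set t : 'I_(nboxes lam) | (t < k) && (P t == g :> nat)]|.

Definition is_dyck (lam : seq nat) (P : steps lam) : bool :=
  [forall g : 'I_(nrows lam), vcoord P (nboxes lam) g == nth 0 lam g]
  && [forall k : 'I_(nboxes lam).+1, forall g : 'I_(nrows lam),
        (g.+1 < nrows lam) ==> (vcoord P k g.+1 <= vcoord P k g)].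

Definition dyck (lam : seq nat) : {set steps lam} := [set P | is_dyck P].

Definition ret_degree (lam : seq nat) (P : steps lam) (t : 'I_(nboxes lam)) : nat :=
  let g := (P t : nat) in
  let k := t.+1 in
  \max_(d < g.+1 | [forall s : 'I_d.+1, vcoord P k (g - s) == vcoord P k g]) d.

Definition nret (lam : seq nat) (P : steps lam) (d : nat) : nat :=
  #|[set t : 'I_(nboxes lam) | ret_degree P t == d]|.

(* D_lam(i_1,...,i_{m-1}); ivec j stands for i_{j+1} *)
Definition dyck_i (lam : seq nat) (ivec : nat -> nat) : {set steps lam} :=
  [set P in dyck lam | [forall j : 'I_(nrows lam).-1, nret P j.+1 == ivec j]].

Definition qint (p : nat) : {poly int} := \sum_(a < p) 'X^a.

(* right-hand side. Tuples (i_1..i_{m-1}) with some i_j > N contribute 0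
   (since i_j counts indices among 1..N), so the sum is over entries <= N. *)
Definition rhs_poly (lam : seq nat) : {poly int} :=
  \sum_(iv : {ffun 'I_(nrows lam).-1 -> 'I_(nboxes lam).+1})
     (#|dyck_i lam (fun j => if insub j is Some j' then (iv j' : nat) else 0)|)%:R
     * \prod_(j < (nrows lam).-1) (qint j.+2) ^+ (iv j).

(* Main.v *)
Require Import Defs.
From HB Require Import structures.
From mathcomp Require Import all_boot all_order all_algebra.
From mathcomp Require Import fingroup perm zify.
Import GRing.Theory.
Set Implicit Arguments. Unset Strict Implicit. Unset Printing Implicit Defensive.

(** All entries of a filling are distinct, so an inversion pair only depends on
    two adjacent columns. A row-standard filling is encoded by the word whose
    [t]-th letter is the row containing the value [t.+1]; Dyck paths are the
    words all of whose prefixes have weakly decreasing content.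

    Delete the largest entry from a filling and move the shortened row, number
    [i], down to the bottom [b] of its block of rows of equal length. This
    removes exactly [b - i] inversions, so summing over the rows of a block of
    size [p] gives a factor [1 + q + ... + q^(p-1)]. Deleting the last step of a
    Dyck path, which is necessarily at the bottom [b] of a block of size [p] and
    has return degree [p - 1], gives the same recursion. *)

(** * Inversions between two rows *)

(** [r] holds the smaller entry in column [j]. The flag [c] decides when one of the right neighbours
    is missing; it will stand for [r] lying below [r']. *)
Definition column_inv (c : bool) (r r' : seq nat) (j : nat) : bool :=
  [&& j < size r, j < size r', nth 0 r j < nth 0 r' j &
      if (j.+1 < size r) && (j.+1 < size r')
      then nth 0 r' j.+1 < nth 0 r j.+1 else c].

Definition row_inv (c : bool) (r r' : seq nat) : nat :=
  \sum_(j < size r) column_inv c r r' j.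

Lemma row_invE c r r' M : size r <= M ->
  row_inv c r r' = \sum_(j < M) column_inv c r r' j.
Proof.
move=> le_rM; rewrite /row_inv (big_ord_widen _ (fun j => column_inv c r r' j : nat) le_rM).
rewrite [RHS](bigID (fun j : 'I_M => j < size r)) /= [X in _ + X]big1 ?addn0 //.
by move=> j; rewrite /column_inv => /negbTE ->.
Qed.

Lemma row_invE_r c r r' M : size r' <= M ->
  row_inv c r r' = \sum_(j < M) column_inv c r r' j.
Proof.
move=> le_rM; rewrite (@row_invE c r r' (maxn (size r) M)) ?leq_maxl //.
have le_M : M <= maxn (size r) M by rewrite leq_maxr.
rewrite (big_ord_widen _ (fun j => column_inv c r r' j : nat) le_M).
rewrite [LHS](bigID (fun j : 'I__ => j < M)) /= [X in _ + X]big1 ?addn0 //.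
move=> j; rewrite -leqNgt /column_inv => ltMj.
by rewrite [j < size r']ltnNge (leq_trans le_rM ltMj) /= andbF.
Qed.

Lemma row_inv_diag c r : row_inv c r r = 0.
Proof. by apply: big1 => j _; rewrite /column_inv ltnn !andbF. Qed.

(** * Effect of a new maximum at the end of a row *)

Section RemoveMaximum.
Variables (x y : seq nat) (N : nat).
Hypothesis y_lt : all (fun z => z < N) y.

Let nth_y j : j < size y -> nth 0 y j < N.
Proof. by move=> lt_j; move/all_nthP: y_lt; apply. Qed.

(** In column [size x] the new entry exceeds that of [y], so it gives no inversion there. In the
    column before, it wins the comparison of right neighbours, as the flag [true] does when that
    neighbour is absent. *)
Lemma row_inv_rcons_long_l c : size x < size y ->
  row_inv c (rcons x N) y = row_inv true x y.
Proof.
move=> lt_xy; rewrite /row_inv size_rcons big_ord_recr /=.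
rewrite [X in _ + X](_ : _ = 0) ?addn0; last first.
  rewrite /column_inv nth_rcons ltnn eqxx; have /ltnW/leq_gtF -> := nth_y lt_xy.
  by rewrite /= !andbF.
apply: eq_bigr => j _; have lt_j := ltn_ord j.
have lt_j1y : j.+1 < size y by lia.
rewrite /column_inv size_rcons !nth_rcons lt_j (ltnW lt_j1y) lt_j1y !ltnS (ltnW lt_j) lt_j /= andbT.
case: (ltnP j.+1 (size x)) => // le_xj; have -> : j.+1 == size x by lia.
by rewrite nth_y.
Qed.

(** As right neighbour of an entry of [x], the maximum rules out an inversion, hence the flag
    [false]. Its own column adds one pair, decided by [c] since nothing stands to its right. *)
Lemma row_inv_rcons_long_r c : size x < size y ->
  row_inv c y (rcons x N) = row_inv false y x + c.
Proof.
move=> lt_xy; rewrite (@row_invE_r c _ _ (size x).+1) ?size_rcons //.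
rewrite (@row_invE_r false _ _ (size x)) // big_ord_recr /=; congr (_ + _).
  apply: eq_bigr => j _; have lt_j := ltn_ord j.
  have lt_j1y : j.+1 < size y by lia.
  rewrite /column_inv size_rcons !nth_rcons lt_j (ltnW lt_j1y) lt_j1y !ltnS (ltnW lt_j) lt_j /=.
  case: (ltnP j.+1 (size x)) => // le_xj; have -> : j.+1 == size x by lia.
  by rewrite (leq_gtF (ltnW (nth_y lt_j1y))).
by rewrite /column_inv size_rcons nth_rcons ltnn eqxx lt_xy ltnSn nth_y //= ltnn andbF.
Qed.

(** Here and in the next lemma the maximum stands in a column beyond the end of [y], so it is never
    compared with an entry of [y]. *)
Lemma row_inv_rcons_short_l c : size y <= size x ->
  row_inv c (rcons x N) y = row_inv c x y.
Proof.
move=> le_yx; rewrite !(@row_invE_r c _ _ (size y)) //.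
apply: eq_bigr => j _; have lt_j := ltn_ord j.
rewrite /column_inv size_rcons !nth_rcons.
have lt_jx : j < size x by lia.
rewrite lt_jx !ltnS (ltnW lt_jx) lt_jx /=.
case: (ltnP j.+1 (size y)) => lt_j1y; last by rewrite andbF.
by have -> : j.+1 < size x by lia.
Qed.

Lemma row_inv_rcons_short_r c : size y <= size x ->
  row_inv c y (rcons x N) = row_inv c y x.
Proof.
move=> le_yx; apply: eq_bigr => j _; have lt_j := ltn_ord j.
rewrite /column_inv size_rcons !nth_rcons.
have lt_jx : j < size x by lia.
rewrite lt_jx !ltnS (ltnW lt_jx) lt_jx /=.
case: (ltnP j.+1 (size y)) => lt_j1y //.
by have -> : j.+1 < size x by lia.
Qed.

End RemoveMaximum.


(** * Two summation identities *)

Lemma sum_pairs_split (T : finType) (b : T) (A : T -> T -> nat) : A b b = 0 ->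
  \sum_k \sum_k' A k k' =
  \sum_(k | k != b) (A b k + A k b) + \sum_(k | k != b) \sum_(k' | k' != b) A k k'.
Proof.
move=> Abb; rewrite (bigD1 b) //= (bigD1 b) //= Abb add0n big_split /= -addnA.
congr (_ + _); rewrite -big_split /=; apply: eq_bigr => k _.
by rewrite (bigD1 b).
Qed.

Lemma sum_ord_interval n i b : b <= n -> \sum_(k < n) (i <= k < b) = b - i.
Proof.
move=> le_bn; rewrite -(big_mkord xpredT (fun k => (i <= k < b) : nat)).
have [le_ib|lt_bi] := leqP i b; last first.
  rewrite big_nat big1 => [|k _]; lia.
rewrite (big_cat_nat (leq0n i)) ?(leq_trans le_ib) //=.
rewrite (big_cat_nat le_ib le_bn) /=.
rewrite big_nat big1 => [|k ?]; last lia.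
rewrite [X in _ + (_ + X)]big_nat [X in _ + (_ + X)]big1 => [|k ?]; last lia.
rewrite add0n addn0 big_nat (eq_bigr (fun=> 1)) => [|k ?]; last lia.
by rewrite -big_nat sum_nat_const_nat muln1.
Qed.

(** * Words and the inversions of the fillings they encode *)

Section Words.
Variable m : nat.
Implicit Types (s : seq 'I_m.+1) (h : nat -> nat) (i b g : 'I_m.+1).

Definition occ s (g : nat) : nat := count (fun x : 'I_m.+1 => x == g :> nat) s.

(* Row [g] of the filling encoded by [s]: the value [t.+1] sits in row
   [nth ord0 s t]. *)
Definition positions s (g : nat) : seq nat :=
  [seq t <- iota 1 (size s) | nth ord0 s t.-1 == g :> nat].

Definition inversions s : nat :=
  \sum_(i < m.+1) \sum_(i' < m.+1)
     row_inv (i' < i) (positions s i) (positions s i').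

Lemma occ_rcons s i (g : nat) : occ (rcons s i) g = occ s g + (i == g :> nat).
Proof. by rewrite /occ -cats1 count_cat /= addn0. Qed.

Lemma positions_rcons s i (g : nat) : positions (rcons s i) g =
  if i == g :> nat then rcons (positions s g) (size s).+1 else positions s g.
Proof.
rewrite /positions size_rcons.
have -> : iota 1 (size s).+1 = rcons (iota 1 (size s)) (size s).+1.
  by rewrite -cats1 -[X in iota 1 X]addn1 iotaD.
rewrite filter_rcons /= nth_rcons ltnn eqxx.
rewrite (@eq_in_filter _ _ (fun t => nth ord0 s t.-1 == g :> nat)) // => t.
rewrite mem_iota => ?; rewrite nth_rcons.
by have -> : t.-1 < size s by lia.
Qed.

Lemma size_positions s (g : nat) : size (positions s g) = occ s g.
Proof.
elim/last_ind: s => [|s i IHs] //; rewrite positions_rcons occ_rcons.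
by case: eqP => _; rewrite ?size_rcons IHs ?addn1 ?addn0.
Qed.

Lemma positions_lt s (g : nat) : all (fun z => z < (size s).+1) (positions s g).
Proof.
by apply/allP => z; rewrite mem_filter mem_iota => /andP[_ /andP[_]]; rewrite add1n.
Qed.

Lemma sorted_positions s (g : nat) : sorted ltn (positions s g).
Proof. exact/sorted_filter/iota_ltn_sorted/ltn_trans. Qed.

Lemma mem_positions s (g : nat) t :
  (t \in positions s g) = [&& 0 < t, t <= size s & nth ord0 s t.-1 == g :> nat].
Proof. by rewrite mem_filter mem_iota add1n ltnS andbC -andbA. Qed.

Lemma positions_map_perm (p : {perm 'I_m.+1}) s g :
  positions (map p s) (p g) = positions s g.
Proof.
rewrite /positions size_map; apply: eq_in_filter => -[|t]; rewrite mem_iota //= add1n ltnS => lt_t.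
by rewrite (nth_map ord0) // !val_eqE (inj_eq perm_inj).
Qed.

Lemma occ_map_perm (p : {perm 'I_m.+1}) s g : occ (map p s) (p g) = occ s g.
Proof. by rewrite -!size_positions positions_map_perm. Qed.

(* Deleting the largest entry, at the end of row [i], and moving the shortened
   row down to the bottom [b] of its block of equal rows: the deleted box forms
   an inversion with the last box of each of the [b - i] rows that are passed,
   and the other inversions are preserved. *)
Lemma inversions_rcons h s i b : i <= b ->
  (forall k : 'I_m.+1, occ s k + (k == b) = h k) ->
  (forall k : 'I_m.+1, k < b -> h b <= h k) ->
  (forall k : 'I_m.+1, b < k -> h k < h b) ->
  inversions (rcons (map (lift_perm b i 1) s) i) = inversions s + (b - i).
Proof.
(* [p] sends [b] to [i] and preserves the order of the other rows, so the tie-breaking flags among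
   those are unchanged. *)
move=> le_ib occ_s h_lt h_gt; set p := lift_perm b i 1; set w := rcons _ _.
have pb : p b = i by rewrite /p lift_perm_id.
have rowb : positions w (p b) = rcons (positions s b) (size s).+1.
  by rewrite positions_rcons pb eqxx -{1}pb positions_map_perm size_map.
have rowk (k : 'I_m.+1) : k != b -> positions w (p k) = positions s k.
  move=> kb; rewrite positions_rcons ifN ?positions_map_perm //.
  by rewrite -pb val_eqE (inj_eq perm_inj) eq_sym.
have pE (k : 'I_m.+1) : k != b -> exists k0 : 'I_m, k = lift b k0 /\ p k = lift i k0.
  rewrite eq_sym => /unlift_some[k0 -> _]; exists k0.
  by rewrite /p lift_perm_lift perm1.
rewrite /inversions (reindex_inj (@perm_inj _ p)) /=.
under eq_bigr do rewrite (reindex_inj (@perm_inj _ p)) /=.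
rewrite (@sum_pairs_split _ b) ?row_inv_diag // [in RHS](@sum_pairs_split _ b) ?row_inv_diag //.
(* Writing [b - i] as the number of [k] with [i <= k < b] allows a comparison row by row; the pairs
   avoiding row [b] are matched first. *)
rewrite -(sum_ord_interval i (ltnW (ltn_ord b))) addnAC; congr (_ + _); last first.
  apply: eq_bigr => k kb; apply: eq_bigr => k' kb'; rewrite !rowk //.
  have [k0 [-> ->]] := pE _ kb; have [k1 [-> ->]] := pE _ kb'.
  by rewrite /= !ltnNge !leq_bump2.
rewrite [X in _ + X](bigD1 b) //= ltnn andbF add0n -big_split /=.
apply: eq_bigr => k kb; rewrite rowb rowk // pb.
have sz_b := occ_s b; have sz_k := occ_s k.
rewrite eqxx addn1 in sz_b; rewrite (negbTE kb) addn0 in sz_k.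
(* A row above [b] is longer than row [b] of [s]; the new box forms an extra inversion with it
   exactly when [p] places it below row [i], that is, when [i <= k]. *)
have [lt_kb|lt_bk] : k < b \/ b < k by move: kb; rewrite -val_eqE /=; lia.
  have lt_sz : size (positions s b) < size (positions s k).
    by rewrite !size_positions; have := h_lt _ lt_kb; lia.
  rewrite row_inv_rcons_long_l ?row_inv_rcons_long_r ?positions_lt //.
  rewrite lt_kb (leq_gtF (ltnW lt_kb)) andbT addnA; congr (_ + nat_of_bool _).
  have [k0 [-> ->]] := pE _ kb; rewrite /= /bump; lia.
(* A row below [b] is no longer than row [b] of [s], is fixed by [p], and never meets the new
   box. *)
have le_sz : size (positions s k) <= size (positions s b).
  by rewrite !size_positions; have := h_gt _ lt_bk; lia.
rewrite row_inv_rcons_short_l ?row_inv_rcons_short_r ?positions_lt //.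
have -> : p k = k.
  have [k0 [e1 e2]] := pE _ kb; apply/val_inj; move: lt_bk; rewrite e2 e1 /= /bump.
  lia.
have -> : (i < k) = (b < k) by lia.
have -> : (k < i) = (k < b) by lia.
by rewrite (leq_gtF (ltnW lt_bk)) andbF addn0.
Qed.

End Words.

(** * Generating functions of words and their recursions *)

Section GeneratingFunctions.
Variable m : nat.
Implicit Types (s : seq 'I_m.+1) (h : nat -> nat) (i b g : 'I_m.+1).

Definition content s h : bool := [forall g : 'I_m.+1, occ s g == h g].

Definition weakly_decreasing h : bool :=
  [forall g : 'I_m.+1, (g.+1 < m.+1) ==> (h g.+1 <= h g)].

Definition remove_box h (b : nat) (g : nat) : nat := h g - (g == b).

Definition block_bottom h i : 'I_m.+1 := [arg max_(b > i | h b == h i) (b : nat)].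

Definition return_degree h (g : nat) : nat :=
  \max_(d < g.+1 | [forall t : 'I_d.+1, h (g - t) == h g]) d.

Definition dyck_word s : bool :=
  all (fun k => weakly_decreasing (occ (take k s))) (iota 0 (size s).+1).

Definition return_weight s : {poly int} :=
  (\prod_(0 <= t < size s)
     qint (return_degree (occ (take t.+1 s)) (nth ord0 s t)).+1)%R.

(** Words of length [n] are represented by finite functions to make the sum finite; [codom] recovers
    the word. *)
Definition inversion_gf n h : {poly int} :=
  (\sum_(P : {ffun 'I_n -> 'I_m.+1} | content (codom P) h)
     'X^(inversions (codom P)))%R.

Definition dyck_gf n h : {poly int} :=
  (\sum_(P : {ffun 'I_n -> 'I_m.+1} | dyck_word (codom P) && content (codom P) h)
     return_weight (codom P))%R.

Lemma weakly_decreasingP h (j k : nat) :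
  weakly_decreasing h -> j <= k -> k <= m -> h k <= h j.
Proof.
move=> /forallP dec_h; elim: k => [|k IHk]; first by rewrite leqn0 => /eqP ->.
rewrite leq_eqVlt => /orP[/eqP -> //|]; rewrite ltnS => le_jk lt_km.
have := dec_h (inord k); rewrite inordK ?ltnS ?(ltnW lt_km) // lt_km /=.
by move/leq_trans; apply; apply: IHk => //; apply: ltnW.
Qed.

Lemma content_eq_occ s h : content s h -> forall g, occ s g = h g.
Proof. by move=> /forallP cs g; apply/eqP. Qed.

Lemma eq_weakly_decreasing h h' :
  (forall g, h g = h' g) -> weakly_decreasing h = weakly_decreasing h'.
Proof.
move=> eq_h; apply: eq_forallb => g; case: ltnP => //= lt_g.
by rewrite -[g.+1]/(nat_of_ord (Ordinal lt_g)) !eq_h.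
Qed.

Lemma eq_return_degree h h' i :
  (forall g, h g = h' g) -> return_degree h i = return_degree h' i.
Proof.
move=> eq_h; apply: eq_bigl => d; apply: eq_forallb => t.
have lt_t : i - t < m.+1 by have := ltn_ord i; lia.
by rewrite -[i - t]/(nat_of_ord (Ordinal lt_t)) !eq_h.
Qed.

Lemma return_degree_le h (g : nat) : return_degree h g <= g.
Proof. by apply/bigmax_leqP => d _; rewrite -ltnS. Qed.

(** A weakly decreasing [h] is constant between [j] and [b] as soon as its values at both ends
    agree, so the degree measures how far up the block of [b] extends. *)
Lemma leq_return_degree h (j b : nat) : weakly_decreasing h -> j <= b -> b <= m ->
  (b - j <= return_degree h b) = (h j == h b).
Proof.
move=> dec_h le_jb le_bm; apply/idP/idP => [|/eqP hj].
  rewrite /return_degree.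
  pose A := [pred d : 'I_b.+1 | [forall t : 'I_d.+1, h (b - t) == h b]].
  have A0 : 0 < #|A|.
    apply/card_gt0P; exists ord0; rewrite inE; apply/forallP => -[[] // lt_t] /=.
    by rewrite subn0.
  have [d Ad] := eq_bigmax_cond (fun d : 'I_b.+1 => d : nat) A0; rewrite -/A => ->.
  move=> le_d; rewrite inE in Ad; have := forallP Ad (inord (b - j)).
  by rewrite inordK ?ltnS // subKn.
have lt_b : b - j < b.+1 by lia.
apply: (@bigmax_sup _ (Ordinal lt_b)) => //=; apply/forallP => t.
have lt_t := ltn_ord t.
rewrite eqn_leq -{1}hj !weakly_decreasingP //; lia.
Qed.

(** By [leq_return_degree] the rows concerned are [b - r], ..., [b] with [r] the return degree, so
    the exponents run over [0], ..., [r]. *)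
Lemma sum_block h b : weakly_decreasing h ->
  (\sum_(i < m.+1 | (i <= b)%N && (h i == h b)) 'X^(b - i) =
   qint (return_degree h b).+1)%R.
Proof.
move=> dec_h; set r := return_degree h b.
have le_rb : r.+1 <= b.+1 by rewrite ltnS return_degree_le.
rewrite /qint (big_ord_widen _ (fun a => 'X^a : {poly int})%R le_rb).
rewrite [RHS](reindex_inj rev_ord_inj) /=.
rewrite (big_ord_widen_cond m.+1 (fun j => b.+1 - j.+1 < r.+1)
   (fun j => 'X^(b.+1 - j.+1) : {poly int})%R) //.
apply: eq_big => [i|i _]; last by rewrite subSS.
rewrite subSS !ltnS andbC; case: leqP => [le_ib|]; rewrite ?andbF //= !andbT.
by rewrite leq_return_degree // -ltnS.
Qed.

Lemma block_bottomP h i (b := block_bottom h i) :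
  [/\ i <= b, h b = h i & forall g, h g = h i -> g <= b].
Proof.
rewrite /b /block_bottom; case: arg_maxnP => //= b' /eqP hb' max_b.
by split=> // [|j /eqP]; [apply: max_b | apply: max_b].
Qed.

Lemma block_bottom_lt h i g : weakly_decreasing h ->
  block_bottom h i < g -> h g < h (block_bottom h i).
Proof.
move=> dec_h lt_g; have [le_i hb max_b] := block_bottomP h i.
have := @weakly_decreasingP h _ _ dec_h (ltnW lt_g).
rewrite -ltnS ltn_ord leq_eqVlt hb => /(_ isT)/orP[/eqP/max_b|//]; lia.
Qed.

(** The only inequality at risk is the one between the bottom row and the next, and it was
    strict. *)
Lemma weakly_decreasing_remove_bottom h i : weakly_decreasing h ->
  weakly_decreasing (remove_box h (block_bottom h i)).
Proof.
move=> dec_h; apply/forallP => g; apply/implyP => lt_g.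
have := implyP (forallP dec_h g) lt_g; rewrite /remove_box.
have [eq_gb|] := eqVneq (g : nat) (block_bottom h i); last lia.
have := @block_bottom_lt h i (Ordinal lt_g) dec_h; rewrite /= eq_gb; lia.
Qed.

(** Determines the rows sent to a removable [b]: a lower row of the same length would exceed row [b]
    after the removal, so [b] is the bottom of its block. *)
Lemma block_bottomE h i b : weakly_decreasing h -> 0 < h b ->
  weakly_decreasing (remove_box h b) ->
  (block_bottom h i == b) = (i <= b) && (h i == h b).
Proof.
move=> dec_h hb_gt0 dec_hb; have [le_i hbb max_b] := block_bottomP h i.
apply/eqP/andP => [<-|[le_ib /eqP hib]]; first by rewrite hbb eqxx.
have le_bb : b <= block_bottom h i by apply: max_b.
apply/val_inj/eqP; rewrite /= eqn_leq le_bb andbT leqNgt; apply/negP => lt_b.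
have := @weakly_decreasingP _ _ _ dec_hb (ltnW lt_b).
by rewrite -ltnS ltn_ord /remove_box eqxx hbb hib gtn_eqF // => /(_ isT); lia.
Qed.

Lemma sum_ffun_rcons n (Q : pred (seq 'I_m.+1)) (f : seq 'I_m.+1 -> {poly int}) :
  (\sum_(P : {ffun 'I_n.+1 -> 'I_m.+1} | Q (codom P)) f (codom P) =
   \sum_i \sum_(P : {ffun 'I_n -> 'I_m.+1} | Q (rcons (codom P) i))
      f (rcons (codom P) i))%R.
Proof.
pose join (x : 'I_m.+1 * {ffun 'I_n -> 'I_m.+1}) : {ffun 'I_n.+1 -> 'I_m.+1} :=
  [ffun t => if unlift ord_max t is Some t' then x.2 t' else x.1].
pose cut (P : {ffun 'I_n.+1 -> 'I_m.+1}) :=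
  (P ord_max, [ffun t : 'I_n => P (lift ord_max t)]).
have joinK : cancel join cut.
  case=> i P; rewrite /cut /join ffunE unlift_none; congr (_, _).
  by apply/ffunP => t; rewrite !ffunE liftK.
have cutK : cancel cut join.
  move=> P; apply/ffunP => t; rewrite ffunE; case: unliftP => [t'|] -> //=.
  by rewrite ffunE.
have codom_join x : codom (join x) = rcons (codom x.2) x.1.
  rewrite !codomE enum_ordSr map_rcons -map_comp /join ffunE unlift_none.
  congr rcons; apply: eq_map => t /=; rewrite ffunE.
  have -> : widen_ord (leqnSn n) t = lift ord_max t.
    by apply: val_inj; rewrite /= /bump leqNgt ltn_ord.
  by rewrite liftK.
rewrite (reindex join) /=; last by exists cut => x _.
by rewrite pair_big_dep /=; apply: eq_big => x; rewrite codom_join.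
Qed.

Lemma content_rcons s h i : 0 < h i ->
  content (rcons s i) h = content s (remove_box h i).
Proof.
move=> hi; apply: eq_forallb => g; rewrite occ_rcons /remove_box.
by case: (eqVneq (g : nat) i) => [->|_]; lia.
Qed.

Lemma content_rcons0 s h i : h i = 0 -> content (rcons s i) h = false.
Proof.
by move=> hi; apply/forallP => /(_ i); rewrite occ_rcons hi eqxx addn1.
Qed.

Lemma codom_perm n (p : {perm 'I_m.+1}) (P : {ffun 'I_n -> 'I_m.+1}) :
  codom [ffun t => p (P t)] = map p (codom P).
Proof. by rewrite !codomE -[RHS]map_comp; apply: eq_map => t /=; rewrite ffunE. Qed.

(** The last letter [i] is the row of the largest value. For fixed [i], relabelling rows by
    [lift_perm b i 1] permutes the possible remaining words and makes [inversions_rcons]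
    applicable. *)
Lemma inversion_gf_rec n h : weakly_decreasing h ->
  (inversion_gf n.+1 h = \sum_(i < m.+1 | (0 < h i)%N)
     'X^(block_bottom h i - i) * inversion_gf n (remove_box h (block_bottom h i)))%R.
Proof.
move=> dec_h; rewrite /inversion_gf.
rewrite (sum_ffun_rcons n (fun s => content s h)
  (fun s => 'X^(inversions s) : {poly int})%R).
rewrite [RHS]big_mkcond /=; apply: eq_bigr => i _; case: posnP => [hi0|hi].
  by rewrite big_pred0 // => P; rewrite content_rcons0.
have [le_ib hb max_b] := block_bottomP h i; set b := block_bottom h i in le_ib hb max_b *.
pose p := lift_perm b i 1; have pb : p b = i by rewrite /p lift_perm_id.
pose relabel (P : {ffun 'I_n -> 'I_m.+1}) : {ffun 'I_n -> 'I_m.+1} := [ffun t => p (P t)].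
have relabel_inj : injective relabel.
  move=> P P' /ffunP eqP; apply/ffunP => t; apply: (@perm_inj _ p).
  by have := eqP t; rewrite !ffunE.
(* [p] moves only rows numbered from [i] to [b], on which [h] is constant. *)
have h_p g : h (p g) = h g.
  have [->|] := eqVneq g b; first by rewrite /p lift_perm_id.
  rewrite eq_sym => /unlift_some[g0 -> _]; rewrite /p lift_perm_lift perm1.
  have [eq_g|[lo hi']] : lift i g0 = lift b g0 :> nat \/
     i <= lift i g0 <= b /\ i <= lift b g0 <= b by rewrite /= /bump; lia.
    by rewrite eq_g.
  have le_m (x : 'I_m.+1) : x <= m by rewrite -ltnS.
  have hE (x : 'I_m.+1) : i <= x <= b -> h x = h i.
    case/andP=> le_ix le_xb; apply/eqP; rewrite eqn_leq -{2}hb.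
    by rewrite !weakly_decreasingP.
  by rewrite !hE.
rewrite (reindex_inj relabel_inj) big_distrr /=.
(* As [h] is invariant under [p] and [p b = i], a box added to row [i] after relabelling counts as a
   box added to row [b] before it. *)
have contentE P : content (rcons (codom (relabel P)) i) h = content (codom P) (remove_box h b).
  rewrite -content_rcons ?hb //; rewrite codom_perm.
  apply/forallP/forallP => cP g.
    have /eqP := cP (p g); rewrite !occ_rcons occ_map_perm h_p => <-.
    by rewrite -pb !val_eqE (inj_eq perm_inj).
  have /eqP := cP ((p^-1)%g g); rewrite -[in X in _ -> X](permKV p g) h_p => <-.
  rewrite !occ_rcons occ_map_perm.
  by rewrite -pb !val_eqE (inj_eq perm_inj).
apply: eq_big => [P|P]; rewrite contentE // => cP.
rewrite codom_perm (@inversions_rcons _ h) // ?exprD 1?mulrC // => g.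
- have := content_eq_occ cP g; rewrite /remove_box val_eqE => ->.
  by case: eqP => [->|_]; rewrite ?hb; lia.
- by move=> lt_gb; apply: weakly_decreasingP => //; [apply: ltnW | rewrite -ltnS].
- exact: block_bottom_lt.
Qed.

Lemma dyck_word_last s : dyck_word s -> weakly_decreasing (occ s).
Proof.
by move=> /allP/(_ (size s)); rewrite take_size; apply; rewrite mem_iota /=.
Qed.

Lemma take_rcons s i k : k <= size s -> take k (rcons s i) = take k s.
Proof. by move=> le_k; rewrite -cats1 takel_cat. Qed.

Lemma dyck_word_rcons s i :
  dyck_word (rcons s i) = dyck_word s && weakly_decreasing (occ (rcons s i)).
Proof.
rewrite /dyck_word size_rcons -[(size s).+2]addn1 iotaD all_cat all_seq1 add0n.
congr (_ && _); last by rewrite take_oversize ?size_rcons.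
apply: eq_in_all => k; rewrite mem_iota add0n ltnS => le_k.
by rewrite take_rcons.
Qed.

Lemma return_weight_rcons s i : (return_weight (rcons s i) =
  return_weight s * qint (return_degree (occ (rcons s i)) i).+1)%R.
Proof.
rewrite /return_weight size_rcons big_nat_recr //=; congr (_ * _)%R.
  apply: eq_big_nat => t /andP[_ lt_t]; rewrite take_rcons //.
  by rewrite nth_rcons lt_t.
by rewrite nth_rcons ltnn eqxx -(size_rcons s i) take_size.
Qed.

Lemma dyck_gf_eq0 n h : ~~ weakly_decreasing h -> dyck_gf n h = 0%R.
Proof.
move=> ndec_h; apply: big_pred0 => P; apply/negP => /andP[/dyck_word_last dec_P cP].
by rewrite -(eq_weakly_decreasing (content_eq_occ cP)) dec_P in ndec_h.
Qed.

(** The factor of the last step depends only on its direction [b] and the endpoint [h]. Rows whose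
    shortening breaks the decreasing order stay in the sum; their terms vanish by [dyck_gf_eq0]. *)
Lemma dyck_gf_rec n h : weakly_decreasing h ->
  (dyck_gf n.+1 h = \sum_(b < m.+1 | (0 < h b)%N)
     qint (return_degree h b).+1 * dyck_gf n (remove_box h b))%R.
Proof.
move=> dec_h; rewrite /dyck_gf.
rewrite (sum_ffun_rcons n (fun s => dyck_word s && content s h) return_weight).
rewrite [RHS]big_mkcond /=; apply: eq_bigr => i _; case: posnP => [hi0|hi].
  by rewrite big_pred0 // => P; rewrite content_rcons0 ?andbF.
rewrite big_distrr /=; apply: eq_big => [P|P /andP[_ cP]].
  rewrite dyck_word_rcons -content_rcons //.
  case cP: (content (rcons _ _) h); rewrite ?andbF ?andbT //.
  by rewrite (eq_weakly_decreasing (content_eq_occ cP)) dec_h andbT.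
by rewrite return_weight_rcons mulrC (eq_return_degree _ (content_eq_occ cP)).
Qed.

Lemma inversion_gf_dyck n h : weakly_decreasing h -> inversion_gf n h = dyck_gf n h.
Proof.
elim: n h => [|n IHn] h dec_h.
  have codom0 (P : {ffun 'I_0 -> 'I_m.+1}) : codom P = [::].
    by apply/size0nil; rewrite size_codom card_ord.
  apply: eq_big => P; rewrite codom0.
    suff dec0 : weakly_decreasing (@occ m [::]) by rewrite /dyck_word /= dec0.
    by apply/forallP => g; rewrite /occ implybT.
  move=> _; rewrite /return_weight big_nil /inversions big1 ?expr0 // => i _.
  by rewrite big1 // => j _; rewrite /row_inv big_ord0.
rewrite inversion_gf_rec // dyck_gf_rec //.
(* Only removable [b] survive on the right; the rows [i] on the left are then grouped by their block
   bottom, which is always removable. *)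
rewrite [RHS](bigID (fun b : 'I_m.+1 => weakly_decreasing (remove_box h b))) /=.
rewrite [X in (_ + X)%R]big1 ?addr0; last first.
  by move=> b /andP[_ nd]; rewrite dyck_gf_eq0 ?mulr0.
rewrite (partition_big (block_bottom h)
  (fun b : 'I_m.+1 => (0 < h b) && weakly_decreasing (remove_box h b))) /=; last first.
  move=> i hi; have [_ -> _] := block_bottomP h i.
  by rewrite hi weakly_decreasing_remove_bottom.
(* [sum_block] expands the [q]-integer over the block of [b]; there [0 < h i] is automatic from
   [h i = h b]. *)
apply: eq_bigr => b /andP[hb dec_hb]; rewrite -IHn // -sum_block // big_distrl /=.
apply: eq_big => [i|i /andP[_ /eqP ->]] //.
rewrite block_bottomE //; case: eqP => [->|]; rewrite ?hb ?andbF //.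
Qed.

End GeneratingFunctions.

(** * The right-hand side as a sum over Dyck words *)

Section Dyck.
Variables (a : nat) (l : seq nat).
Local Notation lam := (a :: l).
Local Notation m := (size l).
Local Notation N := (nboxes (a :: l)).
Implicit Type P : {ffun 'I_N -> 'I_m.+1}.

Lemma vcoordE P k (g : nat) : vcoord (P : steps lam) k g = occ (take k (codom P)) g.
Proof.
rewrite /vcoord cardsE cardE size_filter /occ codomE -map_take count_map.
have -> : take k (enum 'I_N) = [seq t <- enum 'I_N | (t : 'I_N) < k].
  apply: (inj_map val_inj); rewrite map_take -[RHS](filter_map val (fun t => t < k)) !val_enum_ord.
  rewrite take_iota; have [le_kN|lt_Nk] := leqP k N.
    by rewrite (filter_iota_ltn 0 le_kN).
  rewrite -[LHS](@filter_predT) ; apply: eq_in_filter => t.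
  by rewrite mem_iota add0n /= => lt_tN; rewrite (ltn_trans lt_tN).
by rewrite [RHS]count_filter enumT; apply: eq_count => t; rewrite /= andbC.
Qed.

Lemma is_dyckE P :
  is_dyck (P : steps lam) = dyck_word (codom P) && content (codom P) (nth 0 lam).
Proof.
have sizeP : size (codom P) = N by rewrite size_codom card_ord.
rewrite /is_dyck andbC; congr (_ && _).
  apply/forallP/allP => [dP k|dP k].
    rewrite mem_iota add0n sizeP => /= lt_k; have := dP (Ordinal lt_k).
    by under eq_forallb do rewrite !vcoordE.
  under eq_forallb do rewrite !vcoordE.
  by apply: dP; rewrite mem_iota add0n sizeP ltn_ord.
by apply: eq_forallb => g; rewrite vcoordE take_oversize ?sizeP.
Qed.

Lemma ret_degreeE P (t : 'I_N) :
  ret_degree (P : steps lam) t = return_degree (occ (take t.+1 (codom P))) (P t).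
Proof.
by apply: eq_bigl => d; apply: eq_forallb => k; rewrite !vcoordE.
Qed.

Lemma return_weightE P :
  (return_weight (codom P) = \prod_(t < N) qint (ret_degree (P : steps lam) t).+1)%R.
Proof.
rewrite /return_weight size_codom card_ord big_mkord; apply: eq_bigr => t _.
rewrite ret_degreeE; congr (qint (return_degree _ _).+1).
rewrite codomE (nth_map t) ?size_enum_ord //; congr (_ (P _)).
by apply: val_inj; rewrite /= nth_enum_ord.
Qed.

Lemma prod_ret_degree P :
  (\prod_(t < N) qint (ret_degree (P : steps lam) t).+1 =
   \prod_(j < m) qint j.+2 ^+ nret (P : steps lam) j.+1)%R.
Proof.
have lt_ret t : ret_degree (P : steps lam) t < m.+1.
  by rewrite ret_degreeE (leq_ltn_trans (return_degree_le _ _)).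
(* Steps are grouped by degree. Degree 0 contributes [qint 1 = 1] and drops out, leaving the degrees
   [j.+1] with [j < m]. *)
rewrite (partition_big (fun t => Ordinal (lt_ret t)) xpredT) //= big_ord_recl.
rewrite big1 ?mul1r; last first.
  move=> t /eqP/(congr1 val)/= ->; by rewrite /qint big_ord1 expr0.
apply: eq_bigr => j _; rewrite /nret cardsE -prodr_const.
apply: eq_big => [t|t /eqP/(congr1 val)/= -> //].
by rewrite -val_eqE unfold_in.
Qed.

Lemma rhs_polyE : rhs_poly lam = dyck_gf m N (nth 0 lam).
Proof.
rewrite /rhs_poly /dyck_gf.
under eq_bigr => iv _.
  rewrite -sum1_card natr_sum big_distrl /= big_mkcond /=.
  over.
rewrite exchange_big /= [RHS]big_mkcond /=; apply: eq_bigr => P _.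
rewrite -is_dyckE return_weightE prod_ret_degree.
have lt_nret j : nret (P : steps lam) j < N.+1.
  by rewrite ltnS (leq_trans (max_card _)) ?card_ord.
(* The tuple of return counts of [P] is the only one under which [P] can be counted; it is in range
   because there are [N] steps. *)
pose iv0 : {ffun 'I_m -> 'I_N.+1} := [ffun j : 'I_m => Ordinal (lt_nret j.+1)].
rewrite (bigD1 iv0) //= [X in (_ + X)%R]big1 ?addr0 => [|iv ne_iv].
  rewrite !inE; case: ifP => [/andP[-> _]|].
    by rewrite mul1r; apply: eq_bigr => j _; rewrite ffunE.
  case: is_dyck => //= /negbT/forallPn[j].
  by rewrite valK /= ffunE eqxx.
rewrite !inE; case: ifP => // /andP[_ /forallP eq_iv]; case/eqP: ne_iv.
apply/ffunP => j; apply/val_inj; rewrite ffunE /=.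
by have := eq_iv j; rewrite valK => /eqP.
Qed.

End Dyck.

(** * Bijection between row-standard fillings and words of content [lam] *)

Section Fillings.
Variables (a : nat) (l : seq nat).
Local Notation lam := (a :: l).
Local Notation m := (size l).
Local Notation N := (nboxes (a :: l)).
Hypothesis dec_lam : weakly_decreasing m (nth 0 lam).
Implicit Types (P : {ffun 'I_N -> 'I_m.+1}) (tau : filling lam).

(** Past the end of a row, [nth] returns its default 0, which is also the code for an absent box. *)
Definition filling_of P : filling lam :=
  [ffun p : 'I_m.+1 * 'I_a => inord (nth 0 (positions (codom P) p.1) p.2)].

(** The default [ord0] is never reached for a row-standard [tau], in which every value [t.+1]
    occurs. *)
Definition word_of tau : {ffun 'I_N -> 'I_m.+1} :=
  [ffun t : 'I_N => odflt ord0
     [pick i : 'I_m.+1 | [exists j : 'I_a, tau (i, j) == t.+1 :> nat]]].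

Lemma size_word P : size (codom P) = N.
Proof. by rewrite size_codom card_ord. Qed.

Lemma nth_word P (t : 'I_N) : nth ord0 (codom P) t = P t.
Proof.
rewrite codomE (nth_map t) ?size_enum_ord //; congr (P _).
by apply: val_inj; rewrite /= nth_enum_ord.
Qed.

Lemma row_le_ncols (i : 'I_m.+1) : nth 0 lam i <= a.
Proof. by apply: (weakly_decreasingP dec_lam (leq0n i)); rewrite -ltnS. Qed.

Lemma filling_ofE P (p : 'I_m.+1 * 'I_a) :
  filling_of P p = nth 0 (positions (codom P) p.1) p.2 :> nat.
Proof.
rewrite ffunE inordK // ltnS; case: (ltnP p.2 (size (positions (codom P) p.1))).
  move=> lt_p; have := mem_nth 0 lt_p; rewrite mem_positions size_word.
  by case/and3P.
by move=> le_p; rewrite nth_default.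
Qed.

Lemma entryE tau (i : 'I_m.+1) (j : 'I_a) : entry tau i j = tau (i, j).
Proof. by rewrite /entry !valK. Qed.

Section FillingOfWord.
Variable P : {ffun 'I_N -> 'I_m.+1}.
Hypothesis content_P : content (codom P) (nth 0 lam).

Let size_row (i : 'I_m.+1) : size (positions (codom P) i) = nth 0 lam i.
Proof. by rewrite size_positions (content_eq_occ content_P). Qed.

Let inShape_row (i : 'I_m.+1) j : inShape lam i j = (j < size (positions (codom P) i)).
Proof. by rewrite /inShape size_row ltn_ord. Qed.

Let nth_row_mem (i : 'I_m.+1) j : j < size (positions (codom P) i) ->
  exists t : 'I_N, nth 0 (positions (codom P) i) j = t.+1 /\ P t = i.
Proof.
move=> /(mem_nth 0); rewrite mem_positions size_word => /and3P[].
case: (nth _ _ _) => // t _ lt_t /eqP Pt; exists (Ordinal lt_t); split=> //.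
by apply: val_inj; rewrite /= -Pt /= -[t in nth _ _ t]/(nat_of_ord (Ordinal lt_t)) nth_word.
Qed.

(** An entry [t.+1] determines its row [P t], and then its column because rows strictly increase. *)
Let row_inj (i i' : 'I_m.+1) j j' :
  j < size (positions (codom P) i) -> j' < size (positions (codom P) i') ->
  nth 0 (positions (codom P) i) j = nth 0 (positions (codom P) i') j' ->
  i = i' /\ j = j'.
Proof.
move=> lt_j lt_j' eq_nth.
have [t [nth_t Pt]] := nth_row_mem lt_j; have [t' [nth_t' Pt']] := nth_row_mem lt_j'.
have tt' : t = t' by apply: val_inj; apply: succn_inj; rewrite -nth_t -nth_t'.
have ii' : i = i' by rewrite -Pt tt'.
rewrite -ii' in lt_j' eq_nth; split=> //; apply/eqP; rewrite -(nth_uniq 0 lt_j lt_j') ?eq_nth //.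
exact: sorted_uniq ltn_trans ltnn _ (sorted_positions _ _).
Qed.

Let entry_row (i : 'I_m.+1) j :
  entry (filling_of P) i j = nth 0 (positions (codom P) i) j.
Proof.
have [lt_ja|le_aj] := ltnP j a.
  by rewrite -[j]/(nat_of_ord (Ordinal lt_ja)) entryE filling_ofE.
rewrite nth_default ?size_row ?(leq_trans (row_le_ncols i)) //.
by rewrite /entry [insub j]insubN -?leqNgt //; case: insub.
Qed.

Lemma row_standard_filling_of : row_standard (filling_of P).
Proof.
apply/andP; split; [apply/andP; split|].
- apply/forallP => p; rewrite filling_ofE inShape_row; apply/eqP.
  case: ltnP => [lt_p|le_p]; last by rewrite nth_default.
  by have [t [-> _]] := nth_row_mem lt_p.
- apply/forallP => p; apply/forallP => p'; apply/implyP => /andP[].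
  rewrite !inShape_row => /andP[lt_p lt_p'] /eqP/(congr1 val)/=.
  rewrite !filling_ofE => /(row_inj lt_p lt_p')[e1 e2].
  by case: p p' e1 e2 {lt_p lt_p'} => [i j] [i' j'] /= -> /val_inj ->.
apply/forallP => p; apply/forallP => p'; apply/implyP => /andP[/andP[/eqP e1 lt_pp']].
rewrite inShape_row !filling_ofE e1 => lt_p'.
apply: (sorted_ltn_nth ltn_trans) => //; first exact: sorted_positions.
by rewrite inE (ltn_trans lt_pp').
Qed.

Lemma filling_ofK : word_of (filling_of P) = P.
Proof.
apply/ffunP => t; rewrite ffunE.
have mem_t : t.+1 \in positions (codom P) (P t).
  by rewrite mem_positions size_word ltn_ord /= nth_word eqxx.
case: pickP => [i /existsP[j]|/(_ (P t))/existsP[]] /=.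
  rewrite filling_ofE /= => /eqP nth_j; have [lt_j|le_j] := ltnP j (size (positions (codom P) i)).
    have [t' [nth_t' <-]] := nth_row_mem lt_j.
    by congr (P _); apply: val_inj; apply: succn_inj; rewrite -nth_j -nth_t'.
  by rewrite nth_default in nth_j.
(* The content bounds row lengths by [a], so the index of [t.+1] in its row is a legitimate
   column. *)
have lt_ix : index t.+1 (positions (codom P) (P t)) < a.
  apply: leq_trans (row_le_ncols (P t)).
  by rewrite -size_row index_mem.
by exists (Ordinal lt_ix); rewrite filling_ofE /= nth_index.
Qed.

Lemma inv_pair_filling_of (i i' : 'I_m.+1) (j : 'I_a) :
  Defs.inv_pair (filling_of P) i i' j =
  column_inv (i' < i) (positions (codom P) i) (positions (codom P) i') j.
Proof.
rewrite /Defs.inv_pair !inShape_row !entry_row /column_inv.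
have [<-|ne_ii'] := eqVneq (i : nat) i'; first by rewrite ltnn !andbF.
have [lt_j|] := ltnP j (size (positions (codom P) i)) => //=.
have [lt_j'|] := ltnP j (size (positions (codom P) i')) => //=.
suff -> : least_r (filling_of P) i i' j = 1.
  by rewrite addn1.
have a_gt0 : 0 < a by apply: leq_ltn_trans (ltn_ord j).
rewrite /least_r /= -[X in iota 1 X](prednK a_gt0) /=.
(* The search stops at distance 1: either a right neighbour is missing, or the two lie in different
   rows and hence differ. *)
suff -> : stop_at (filling_of P) i i' j 1 by [].
rewrite /stop_at !inShape_row !entry_row addn1.
case: (ltnP j.+1 _) => //= lt_j1; case: (ltnP j.+1 _) => //= lt_j1'.
by apply/eqP => /(row_inj lt_j1 lt_j1')[ii' _]; rewrite ii' eqxx in ne_ii'.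
Qed.

Lemma ninv_filling_of : ninv (filling_of P) = inversions (codom P).
Proof.
rewrite /inversions.
under eq_bigr => i _ do under eq_bigr => i' _ do
  rewrite (@row_invE _ _ _ a) ?size_row ?row_le_ncols //.
rewrite pair_bigA /= pair_bigA /= /ninv -sum1_card big_mkcond /=.
apply: eq_bigr => -[[i i'] j] _; rewrite inE /= inv_pair_filling_of.
by case: column_inv.
Qed.

End FillingOfWord.

(** This count turns injectivity of a filling on its boxes into surjectivity onto the values from 1
    to [N]. *)
Lemma card_boxes : #|[set p : 'I_m.+1 * 'I_a | inShape lam p.1 p.2]| = N.
Proof.
rewrite /nboxes sumnE (big_nth 0) big_mkord.
under eq_bigr => i _ do
  rewrite -[nth _ _ _]subn0 -(sum_ord_interval 0 (row_le_ncols i)).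
rewrite pair_bigA -sum1_card big_mkcond /=; apply: eq_bigr => -[i j] _.
by rewrite inE /inShape ltn_ord /=; case: ltnP.
Qed.

Section WordOfFilling.
Variable tau : filling lam.
Hypothesis std_tau : row_standard tau.

Let tau_neq0 (p : 'I_m.+1 * 'I_a) : (tau p != 0 :> nat) = inShape lam p.1 p.2.
Proof.
by case/andP: std_tau => /andP[/forallP/(_ p)/eqP].
Qed.

Let tau_inj (p p' : 'I_m.+1 * 'I_a) : tau p != 0 :> nat -> tau p = tau p' -> p = p'.
Proof.
move=> tau_p eq_tau; case/andP: std_tau => /andP[_ /forallP/(_ p)/forallP/(_ p')].
by rewrite -!tau_neq0 -eq_tau tau_p eqxx /= => /eqP.
Qed.

Let tau_surj (x : 'I_N.+1) : x != 0 :> nat -> exists p, tau p = x.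
Proof.
move=> x_neq0; pose B := [set p : 'I_m.+1 * 'I_a | inShape lam p.1 p.2].
have tauB : tau @: B = [set~ ord0].
  apply/eqP; rewrite eqEcard; apply/andP; split.
    by apply/subsetP => _ /imsetP[p + ->]; rewrite !inE -tau_neq0 -val_eqE.
  rewrite card_in_imset ?card_boxes ?cardsC1 ?card_ord //.
  by move=> p p'; rewrite inE -tau_neq0 => tau_p _; apply: tau_inj.
have : x \in tau @: B by rewrite tauB !inE -val_eqE.
by case/imsetP => p _ ->; exists p.
Qed.

Let word_ofP (i : 'I_m.+1) (j : 'I_a) (t : 'I_N) :
  tau (i, j) = t.+1 :> nat -> word_of tau t = i.
Proof.
move=> tau_ij; rewrite ffunE; case: pickP => [i' /existsP[j' /eqP tau_ij']|/(_ i)/existsP[]].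
  suff [] : (i', j') = (i, j) by [].
  by apply: tau_inj; [rewrite tau_ij' | apply: val_inj; rewrite /= tau_ij tau_ij'].
by exists j; rewrite tau_ij.
Qed.

Lemma positions_word_of (i : 'I_m.+1) :
  positions (codom (word_of tau)) i = mkseq (entry tau i) (nth 0 lam i).
Proof.
(* Strictly increasing lists with the same members are equal; on the right-hand side the increase is
   row-standardness. *)
apply: (irr_sorted_eq ltn_trans ltnn); first exact: sorted_positions.
  apply/(sortedP 0) => j; rewrite size_mkseq => lt_j; rewrite !nth_mkseq ?(ltnW lt_j) //.
  have lt_ja := leq_trans lt_j (row_le_ncols i).
  have /= -> := entryE tau i (Ordinal lt_ja).
  have /= -> := entryE tau i (Ordinal (ltnW lt_ja)).
  case/andP: std_tau => _ /forallP/(_ (i, Ordinal (ltnW lt_ja)))/forallP/(_ (i, Ordinal lt_ja)).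
  by rewrite eqxx ltnSn /inShape ltn_ord /= lt_j.
move=> x; rewrite mem_positions size_word; apply/and3P/mapP.
  case: x => [|t] [] //= _ lt_t.
  rewrite -[t]/(nat_of_ord (Ordinal lt_t)) nth_word.
  have [[i' j'] tau_p] := @tau_surj (Ordinal (lt_t : t.+1 < N.+1)) isT.
  have tau_v : tau (i', j') = (Ordinal lt_t).+1 :> nat by rewrite tau_p.
  rewrite (word_ofP tau_v) => /eqP ii'; exists j'; last by rewrite -ii' entryE tau_v.
  rewrite mem_iota add0n -ii' /=.
  by have := tau_neq0 (i', j'); rewrite tau_v /inShape ltn_ord /= => <-.
case=> j; rewrite mem_iota add0n => /= lt_j ->.
have lt_ja := leq_trans lt_j (row_le_ncols i).
rewrite -[j]/(nat_of_ord (Ordinal lt_ja)) entryE.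
have := tau_neq0 (i, Ordinal lt_ja); rewrite /inShape ltn_ord /= lt_j => tau_nz.
have := ltn_ord (tau (i, Ordinal lt_ja)).
case tauE: (nat_of_ord (tau _)) => [|t]; first by rewrite tauE in tau_nz.
rewrite ltnS => lt_t; split=> //=.
by rewrite -[t]/(nat_of_ord (Ordinal lt_t)) nth_word (word_ofP (tauE : _ = (Ordinal lt_t).+1)).
Qed.

Lemma content_word_of : content (codom (word_of tau)) (nth 0 lam).
Proof.
by apply/forallP => i; rewrite -size_positions positions_word_of size_mkseq.
Qed.

Lemma word_ofK : filling_of (word_of tau) = tau.
Proof.
apply/ffunP => -[i j]; apply: val_inj; rewrite /= filling_ofE /= positions_word_of.
have := tau_neq0 (i, j); rewrite /inShape ltn_ord /=.
case: ltnP => [lt_j _|le_j /negbFE/eqP ->]; first by rewrite nth_mkseq // entryE.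
by rewrite nth_default // size_mkseq.
Qed.

End WordOfFilling.

Lemma inversion_gfE :
  (\sum_(tau : filling lam | row_standard tau) 'X^(ninv tau) =
   inversion_gf m N (nth 0 lam))%R.
Proof.
rewrite /inversion_gf (reindex_onto word_of filling_of filling_ofK) /=.
(* The reindexed sum is over [tau] whose word has content [lam] and which are recovered from that
   word; these are exactly the row-standard ones. *)
apply: eq_big => [tau|tau std_tau].
  apply/idP/andP => [std_tau|[c_tau /eqP <-]].
    by rewrite content_word_of ?word_ofK.
  exact: row_standard_filling_of.
by rewrite -{1}(word_ofK std_tau) ninv_filling_of // content_word_of.
Qed.

End Fillings.

Theorem mainTheorem14 (lam : seq nat) (hlam : is_shape lam) :
  forall k : nat, ((#|S_k lam k|)%:R : int)%R = ((rhs_poly lam)`_k)%R.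
Proof.
case: lam hlam => [|a l]; first by rewrite /is_shape andbF.
move=> /andP[/andP[sorted_lam _] _] k.
have dec_lam : weakly_decreasing (size l) (nth 0 (a :: l)).
  by apply/forallP => g; apply/implyP => lt_g; apply: (sortedP 0 sorted_lam).
(* Both sides are now sums over fillings: the coefficient at [k] of ['X^(ninv tau)] is 1 or 0
   according to whether [ninv tau] equals [k]. *)
rewrite rhs_polyE -inversion_gf_dyck // -inversion_gfE // coef_sum -sum1_card natr_sum.
rewrite [RHS]big_mkcond [LHS]big_mkcond /=; apply: eq_bigr => tau _.
by rewrite inE coefXn eq_sym; case: row_standard => //=; case: eqP.
Qed.
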